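(* Let $H_4(3)$ be the graph on the 16 vertices $c_0,\dots,c_{11},h_0,h_1,h_2,h_3$ whose edges are $\{c_i,c_{i+1}\}$ for $0\le i\le 11$ (indices modulo $12$) and $\{h_j,c_i\}$ for all $0\le j\le 3$, $0\le i\le 11$ with $i\equiv j \pmod 4$. Let $\overline{H_4(3)}$ be its complement. Then $$\mathrm{mr}_+^{\mathbb{C}}(\overline{H_4(3)})=3<4=\mathrm{mr}_+^{\mathbb{R}}(\overline{H_4(3)}).$$
   Context: For a finite simple graph $G$ with vertex set identified with $\{1,\dots,n\}$ and an $n\times n$ Hermitian matrix $A$, the graph $\mathcal{G}(A)$ has vertices $\{1,\dots,n\}$ and edges $\{i,j\}$, $i<j$, exactly when $a_{ij}\ne 0$ (the diagonal is ignored). $\mathrm{mr}_+^{\mathbb{R}}(G)$ is the minimum rank over all real symmetric positive semidefinite $n\times n$ matrices $A$ with $\mathcal{G}(A)=G$, and $\mathrm{mr}_+^{\mathbb{C}}(G)$ is the minimum rank over all complex Hermitian positive semidefinite $n\times n$ matrices $A$ with $\mathcal{G}(A)=G$. The complement of a graph $(V,E)$ is the graph on $V$ whose edges are all two-element subsets of $V$ not in $E$. *)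

(* Defs.v *)
From mathcomp Require Import all_boot all_order all_algebra.
From mathcomp Require Import all_classical all_reals.
From mathcomp Require Import complex.

Set Implicit Arguments.
Unset Strict Implicit.
Unset Printing Implicit Defensive.

Import Order.TTheory GRing.Theory Num.Theory Num.Def.
Local Open Scope ring_scope.
Local Open Scope sesquilinear_scope.

Record sgraph (n : nat) := SGraph {
  adj :> rel 'I_n;
  adj_sym : symmetric adj;
  adj_irr : irreflexive adj }.

Definition compl_adj n (G : sgraph n) : rel 'I_n :=
  [rel i j | (i != j) && ~~ G i j].

Fact compl_adj_sym n (G : sgraph n) : symmetric (compl_adj G).
Proof. by move=> i j; rewrite /compl_adj /= eq_sym adj_sym. Qed.

Fact compl_adj_irr n (G : sgraph n) : irreflexive (compl_adj G).
Proof. by move=> i; rewrite /compl_adj /= eqxx. Qed.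

Definition compl_graph n (G : sgraph n) : sgraph n :=
  SGraph (compl_adj_sym G) (compl_adj_irr G).

(* The relation is only symmetric when A has a symmetric zero pattern, which   *)
(* is the case for the Hermitian matrices it is applied to.                    *)
Definition mxgraph (F : fieldType) n (A : 'M[F]_n) : rel 'I_n :=
  [rel i j | (i != j) && (A i j != 0)].

(* [theta] is the identity for real symmetric matrices, and complex            *)
(* conjugation for complex Hermitian ones.  Over the complex numbers,          *)
(* [0 <= z] means that z is real and nonnegative.                              *)
Definition psdmx (F : numFieldType) (theta : F -> F) n (A : 'M[F]_n) : Prop :=
  A \is hermitianmx n false theta /\
  forall x : 'cV[F]_n, 0 <= (x ^t theta *m A *m x) 0 0.

Definition psd_rank (F : numFieldType) (theta : F -> F) n (G : sgraph n)
    (k : nat) : Prop :=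
  exists A : 'M[F]_n, [/\ psdmx theta A, mxgraph A =2 G & \rank A = k].

(* Every graph is the graph of a positive semidefinite matrix: take the        *)
(* signless Laplacian (here, twice it).                                        *)
Section Laplacian.
Variables (F : numFieldType) (theta : {rmorphism F -> F}).
Hypothesis theta_ge0 : forall z, 0 <= theta z * z.
Variables (n : nat) (G : sgraph n).

Let inc (p : 'I_n * 'I_n) (i : 'I_n) : nat := ((i == p.1) + (i == p.2))%N.

Let lap_nat (i j : 'I_n) : nat :=
  (\sum_(p : 'I_n * 'I_n | G p.1 p.2) inc p i * inc p j)%N.

Let lap : 'M[F]_n := \matrix_(i, j) (lap_nat i j)%:R.

Lemma psd_rank_ex : exists k, psd_rank theta G k.
Proof.
exists (\rank lap), lap; split=> //; first split.
- apply/is_hermitianmxP/matrixP => i j; rewrite expr0 scale1r !mxE rmorph_nat.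
  by congr (_%:R); apply: eq_bigr => p _; rewrite mulnC.
- move=> x; rewrite !mxE.
  pose s p := \sum_i (inc p i)%:R * x i 0.
  suff -> : \sum_j (x ^t theta *m lap) 0 j * x j 0 =
            \sum_(p : 'I_n * 'I_n | G p.1 p.2) theta (s p) * s p.
    by apply: sumr_ge0 => p _; apply: theta_ge0.
  transitivity (\sum_j \sum_i \sum_(p : 'I_n * 'I_n | G p.1 p.2)
      theta ((inc p i)%:R * x i 0) * ((inc p j)%:R * x j 0)).
    apply: eq_bigr => j _; rewrite mxE big_distrl; apply: eq_bigr => i _ /=.
    rewrite !mxE natr_sum mulr_sumr mulr_suml; apply: eq_bigr => p _.
    rewrite natrM rmorphM rmorph_nat /= [theta _ * _]mulrC -!mulrA.
    by congr (_ * _); rewrite mulrCA.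
  under eq_bigr => j _ do rewrite exchange_big.
  rewrite exchange_big; apply: eq_bigr => p _ /=.
  rewrite {2}/s mulr_sumr; apply: eq_bigr => j _.
  by rewrite rmorph_sum mulr_suml.
- move=> i j; rewrite /mxgraph /= mxE pnatr_eq0 sum_nat_eq0.
  case: (altP (i =P j)) => [->|nij] /=; first by rewrite adj_irr.
  apply/idP/idP => [/forallPn[[a b]] | Gij].
    rewrite negb_imply muln_eq0 !addn_eq0 !eqb0 /inc /= => /andP[Gab].
    rewrite negb_or !negb_and !negbK => /andP[]; move: nij.
    move=> nij /orP[] /eqP ei /orP[] /eqP ej; subst => //; last 1 first.
    - by rewrite eqxx in nij.
    - by rewrite eqxx in nij.
    - by rewrite adj_sym.
  apply/forallPn; exists (i, j); rewrite negb_imply /= Gij /=.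
  by rewrite /inc /= !eqxx muln_eq0 !addn_eq0 /= andbF.
Qed.

End Laplacian.

Fact psd_rankR_ex (R : realType) n (G : sgraph n) :
  exists k, `[< psd_rank (idfun : R -> R) G k >].
Proof.
have [|k ?] := @psd_rank_ex R idfun _ n G; last by exists k; apply/asboolP.
by move=> z; rewrite -expr2 sqr_ge0.
Qed.

Fact psd_rankC_ex (R : realType) n (G : sgraph n) :
  exists k, `[< psd_rank (conjC : R[i] -> R[i]) G k >].
Proof.
have [|k ?] := @psd_rank_ex R[i] conjC _ n G; last by exists k; apply/asboolP.
by move=> z; rewrite mulrC mul_conjC_ge0.
Qed.

Definition mr_plusR (R : realType) n (G : sgraph n) : nat :=
  ex_minn (psd_rankR_ex R G).

Definition mr_plusC (R : realType) n (G : sgraph n) : nat :=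
  ex_minn (psd_rankC_ex R G).

(* The vertices are c_i = lshift 4 i for i : 'I_12 and h_j = rshift 12 j for   *)
(* j : 'I_4.                                                                   *)
Definition H43_adj : rel 'I_(12 + 4) := fun u v =>
  match fintype.split u, fintype.split v with
  | inl i, inl i' => (i' == i.+1 %% 12 :> nat) || (i == i'.+1 %% 12 :> nat)
  | inl i, inr j | inr j, inl i => i == j %[mod 4]
  | inr _, inr _ => false
  end%N.

Fact H43_adj_sym : symmetric H43_adj.
Proof.
by move=> u v; rewrite /H43_adj; case: fintype.split => i; case: fintype.split => j //; rewrite orbC.
Qed.

Fact H43_adj_irr : irreflexive H43_adj.
Proof.
move=> u; rewrite /H43_adj; case: fintype.split => // -[i ilt] /=; rewrite orbb.
by do 12 (case: i ilt => [//|i] ilt).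
Qed.

Definition H43 : sgraph (12 + 4) := SGraph H43_adj_sym H43_adj_irr.

(* Main.v *)
Require Import Defs.
From mathcomp Require Import all_boot all_order all_algebra.
From mathcomp Require Import all_classical all_reals.
From mathcomp Require Import complex ring.

(** H_4(3) is bipartite, with parts {c_even, h_1, h_3} and {c_odd, h_0, h_2}.
    In a Gram matrix of rank 3 the vectors of the first part are points and those
    of the second part are lines of a projective plane, and the edges say that
    they form a Moebius-Kantor configuration 8_3, which exists over the complex
    numbers and not over the reals: projecting the line h_0 onto the line h_2
    from h_1 and back from h_3 permutes c_0, c_4, c_8 cyclically while fixing the
    intersection of the two lines, and a real projectivity of order 3 of a line
    has no fixed point.  This uses only the zero pattern and the rank.  In real
    dimension 4 there is no obstruction: the points are generic and each line is
    the vector orthogonal to its three neighbours. *)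

Set Implicit Arguments.
Unset Strict Implicit.
Unset Printing Implicit Defensive.

Import Order.TTheory GRing.Theory Num.Theory Num.Def.
Local Open Scope ring_scope.
Local Open Scope sesquilinear_scope.

(** * Rank and invertible diagonal submatrices *)

Section DiagonalSubmatrix.
Variables (F : fieldType) (m n r : nat) (A : 'M[F]_(m, n)).
Variables (f : 'I_r -> 'I_m) (g : 'I_r -> 'I_n).
Hypothesis diag0 : forall k l, k != l -> A (f k) (g l) = 0.
Hypothesis diagN0 : forall k, A (f k) (g k) != 0.

Lemma row_free_diag_mxsub : row_free (rowsub f A).
Proof.
have Sdiag : mxsub f g A = diag_mx (\row_k A (f k) (g k)).
  apply/matrixP => k l; rewrite !mxE; case: eqVneq => [->|/diag0 ->] //.
have : mxsub f g A \in unitmx.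
  rewrite unitmxE Sdiag det_diag unitfE; apply/prodf_neq0 => k _.
  by rewrite mxE.
rewrite -row_free_unit -!row_leq_rank => /leq_trans; apply.
suff -> : mxsub f g A = rowsub f A *m colsub g 1%:M by apply: mxrankM_maxl.
by rewrite mulmx_colsub mulmx1; apply/matrixP => k l; rewrite !mxE.
Qed.

Lemma leq_rank_diag_mxsub : (r <= \rank A)%N.
Proof. by rewrite -(eqP row_free_diag_mxsub) mxrankS ?rowsub_sub. Qed.

(** At rank [r] the rows [f k] span the row space, and column [g k], zero on all the others of them,
    reads off the coefficient of row [f k]. *)
Lemma diag_mxsub_expansion i j : (\rank A <= r)%N ->
  A i j = \sum_k A i (g k) / A (f k) (g k) * A (f k) j.
Proof.
move=> rkA; have /submxP[X defA] : (A <= rowsub f A)%MS.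
  by rewrite -(geq_leqif (mxrank_leqif_sup (rowsub_sub f A)))
             (eqP row_free_diag_mxsub).
have AE i' j' : A i' j' = \sum_k X i' k * A (f k) j'.
  by rewrite {1}defA mxE; apply: eq_bigr => k _; rewrite !mxE.
rewrite AE; apply: eq_bigr => k _; congr (_ * _).
rewrite [A i _]AE (bigD1 k) //= big1 ?addr0 ?mulfK // => l lk.
by rewrite diag0 ?mulr0.
Qed.

End DiagonalSubmatrix.

(** * The zero pattern, on natural numbers so that it computes *)

Definition H43_nat (a b : nat) : bool :=
  match a < 12, b < 12 with
  | true, true => (b == a.+1 %% 12) || (a == b.+1 %% 12)
  | true, false => a == b - 12 %[mod 4]
  | false, true => b == a - 12 %[mod 4]
  | false, false => false
  end%N.

Lemma H43_natE (i j : 'I_(12 + 4)) : H43 i j = H43_nat i j.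
Proof.
rewrite /= /H43_adj /H43_nat.
have ge12 (k : 'I_4) : (12 + k < 12)%N = false by rewrite ltnNge leq_addr.
by case: (splitP i) => a ia; case: (splitP j) => b jb;
  rewrite ?ia ?jb ?ltn_ord ?ge12 ?addKn.
Qed.

(* [vtx i] is c_i for i < 12, and [vtx (12 + j)] is h_j. *)
Definition vtx (a : nat) : 'I_(12 + 4) := @inord 15 a.

Section Pattern.
Variables (F : fieldType) (A : 'M[F]_(12 + 4)).
Hypothesis graphA : mxgraph A =2 compl_graph H43.

Lemma H43_pattern a b : (a < 16)%N -> (b < 16)%N -> a != b ->
  (A (vtx a) (vtx b) == 0) = H43_nat a b.
Proof.
move=> lta ltb nab; have := graphA (vtx a) (vtx b).
rewrite /mxgraph /= /compl_adj /= -[H43_adj _ _]/(H43 _ _) H43_natE.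
by rewrite -val_eqE /= !inordK // nab /= => /negb_inj.
Qed.

(* The lines c_3, c_1, h_0 are the sides of the triangle of points c_0, c_4,   *)
(* c_2: this gives a diagonal submatrix of order 3 of invertible entries.      *)
Definition base_pts := [tuple vtx 0; vtx 4; vtx 2].
Definition base_lines := [tuple vtx 3; vtx 1; vtx 12].

Lemma base_offdiag k l : k != l -> A (tnth base_pts k) (tnth base_lines l) = 0.
Proof.
move=> nkl; apply/eqP; move: k l nkl.
by do 2 case=> [[|[|[|//]]] ?]; rewrite ?eqxx //= !(tnth_nth (vtx 0)) /= H43_pattern.
Qed.

Lemma base_diag k : A (tnth base_pts k) (tnth base_lines k) != 0.
Proof.
by case: k => [[|[|[|//]]] ?]; rewrite !(tnth_nth (vtx 0)) /= H43_pattern.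
Qed.

Lemma compl_H43_rank_ge3 : (3 <= \rank A)%N.
Proof. exact: leq_rank_diag_mxsub base_offdiag base_diag. Qed.

End Pattern.

(** * The lower bound over the reals *)

(* In the basis c_0, c_4, c_2 the points are c_8 = (a, b, 0), h_1 = (s, 0, t), *)
(* h_3 = (0, u, v), c_6 = (x, y, z), c_10 = (x', y', z'); the five equations   *)
(* are the incidences with the lines c_5, c_11, c_9, c_7, h_2.  They force     *)
(* S ^+ 2 + S * T + T ^+ 2 = 0 for S = a * u * t and T = b * v * s.            *)
Lemma moebius_kantor_not_real (R : realDomainType)
    (a b s t u v x y z x' y' z' : R) :
    a != 0 -> u != 0 -> t != 0 -> z != 0 -> z' != 0 ->
    x * t = z * s -> y' * v = z' * u ->
    a * (y' * t) = b * (x' * t - z' * s) ->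
    x * (b * v) - y * (a * v) + z * (a * u) = 0 ->
    x * y' = x' * y -> False.
Proof.
move=> a0 u0 t0 z0 z'0 hx hy' h9 h7 h2.
pose S := a * u * t; pose T := b * v * s.
have e1 : z' * (S + T) = b * v * t * x'.
  have : z' * (S + T) - b * v * t * x' = (z' * u - y' * v) * (a * t)
     + v * (a * (y' * t) - b * (x' * t - z' * s)) by rewrite /S /T; ring.
  by rewrite hy' h9 !subrr mul0r mulr0 addr0 => /subr0_eq.
have e2 : z * (S + T) = y * a * v * t.
  have : z * (S + T) - y * a * v * t = (z * s - x * t) * (b * v)
     + t * (x * (b * v) - y * (a * v) + z * (a * u)) by rewrite /S /T; ring.
  by rewrite hx h7 subrr mul0r mulr0 addr0 => /subr0_eq.
(* The product of [e1] and [e2] contains x' * y; the incidence with h_2 trades it for x * y', which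
   c_5 and c_11 turn into S * T. *)
have e3 : z * z' * ((S + T) * (S + T)) = z * z' * (S * T).
  transitivity (z' * (S + T) * (z * (S + T))); first by ring.
  rewrite e1 e2; transitivity (a * b * v * t * t * v * (x' * y)); first by ring.
  rewrite -h2; transitivity (a * b * v * t * (x * t) * (y' * v)); first by ring.
  by rewrite hx hy' /S /T; ring.
have zz0 : z * z' != 0 by rewrite mulf_neq0.
(* Doubling S ^+ 2 + S * T + T ^+ 2 makes it a sum of squares, which the order forces to vanish
   termwise. *)
have e4 : S ^+ 2 + T ^+ 2 + (S + T) ^+ 2 = 0.
  have := mulfI zz0 e3 => /eqP; rewrite -subr_eq0 => /eqP e.
  have -> : S ^+ 2 + T ^+ 2 + (S + T) ^+ 2 = ((S + T) * (S + T) - S * T) *+ 2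
    by rewrite mulr2n; ring.
  by rewrite e mul0rn.
have : S ^+ 2 == 0.
  move: e4 => /eqP; rewrite paddr_eq0 ?addr_ge0 ?sqr_ge0 //.
  by rewrite paddr_eq0 ?sqr_ge0 // => /andP[/andP[]].
by rewrite sqrf_eq0 !mulf_eq0 (negPf a0) (negPf u0) (negPf t0).
Qed.

Lemma det2_eq0 (R : idomainType) (al be x1 y1 x2 y2 : R) : al != 0 ->
  x1 * al + y1 * be = 0 -> x2 * al + y2 * be = 0 -> x1 * y2 = y1 * x2.
Proof.
move=> al0 e1 e2; apply: (mulfI al0); apply/eqP; rewrite -subr_eq0.
have -> : al * (x1 * y2) - al * (y1 * x2) =
  y2 * (x1 * al + y1 * be) - y1 * (x2 * al + y2 * be) by ring.
by rewrite e1 e2 !mulr0 subrr.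
Qed.

(** Cramer's rule: the cofactors of the first column combine the three equations into [al] times the
    determinant. *)
Lemma det3_eq0 (R : idomainType) (al be ga x1 y1 z1 x2 y2 z2 x3 y3 z3 : R) :
  al != 0 -> x1 * al + y1 * be + z1 * ga = 0 ->
  x2 * al + y2 * be + z2 * ga = 0 -> x3 * al + y3 * be + z3 * ga = 0 ->
  x1 * (y2 * z3 - z2 * y3) - y1 * (x2 * z3 - z2 * x3)
    + z1 * (x2 * y3 - y2 * x3) = 0.
Proof.
move=> al0 e1 e2 e3; apply: (mulfI al0); rewrite mulr0.
transitivity ((x1 * al + y1 * be + z1 * ga) * (y2 * z3 - z2 * y3)
  - (x2 * al + y2 * be + z2 * ga) * (y1 * z3 - z1 * y3)
  + (x3 * al + y3 * be + z3 * ga) * (y1 * z2 - z1 * y2)); first by ring.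
by rewrite e1 e2 e3 !mul0r subrr addr0.
Qed.

Lemma compl_H43_real_rank_ge4 (R : realFieldType) (A : 'M[R]_(12 + 4)) :
  mxgraph A =2 compl_graph H43 -> (4 <= \rank A)%N.
Proof.
move=> gA; rewrite ltnNge; apply/negP => rkA.
have Av := H43_pattern gA.
have A0 a b (lta : (a < 16)%N) (ltb : (b < 16)%N) (nab : a != b) :
  H43_nat a b -> A (vtx a) (vtx b) = 0.
  by rewrite -Av // => /eqP.
have AN0 a b (lta : (a < 16)%N) (ltb : (b < 16)%N) (nab : a != b) :
  ~~ H43_nat a b -> A (vtx a) (vtx b) != 0.
  by rewrite -Av.
(* The coordinates of row i in the basis of rows c_0, c_4, c_2. *)
pose p i := A i (vtx 3) / A (vtx 0) (vtx 3).
pose q i := A i (vtx 1) / A (vtx 4) (vtx 1).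
pose r i := A i (vtx 12) / A (vtx 2) (vtx 12).
have AE i j : A i j = p i * A (vtx 0) j + q i * A (vtx 4) j + r i * A (vtx 2) j.
  rewrite {1}(diag_mxsub_expansion (base_offdiag gA) (base_diag gA) i j rkA).
  by rewrite !big_ord_recl big_ord0 addr0 addrA !(tnth_nth (vtx 0)).
have p0 a : (a < 16)%N -> a != 3 -> H43_nat a 3 -> p (vtx a) = 0.
  by move=> *; rewrite /p A0 ?mul0r.
have q0 a : (a < 16)%N -> a != 1 -> H43_nat a 1 -> q (vtx a) = 0.
  by move=> *; rewrite /q A0 ?mul0r.
have r0 a : (a < 16)%N -> a != 12 -> H43_nat a 12 -> r (vtx a) = 0.
  by move=> *; rewrite /r A0 ?mul0r.
have pN0 a : (a < 16)%N -> a != 3 -> ~~ H43_nat a 3 -> p (vtx a) != 0.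
  by move=> *; rewrite /p mulf_neq0 ?invr_eq0 ?AN0.
have qN0 a : (a < 16)%N -> a != 1 -> ~~ H43_nat a 1 -> q (vtx a) != 0.
  by move=> *; rewrite /q mulf_neq0 ?invr_eq0 ?AN0.
have rN0 a : (a < 16)%N -> a != 12 -> ~~ H43_nat a 12 -> r (vtx a) != 0.
  by move=> *; rewrite /r mulf_neq0 ?invr_eq0 ?AN0.
have line a b (lta : (a < 16)%N) (ltb : (b < 16)%N) (nab : a != b) :
  H43_nat a b -> p (vtx a) * A (vtx 0) (vtx b) + q (vtx a) * A (vtx 4) (vtx b)
    + r (vtx a) * A (vtx 2) (vtx b) = 0.
  by rewrite -AE; apply: A0.
apply: (@moebius_kantor_not_real R (p (vtx 8)) (q (vtx 8))
  (p (vtx 13)) (r (vtx 13)) (q (vtx 15)) (r (vtx 15))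
  (p (vtx 6)) (q (vtx 6)) (r (vtx 6)) (p (vtx 10)) (q (vtx 10)) (r (vtx 10)));
  rewrite ?pN0 ?qN0 ?rN0 //.
(* The lines c_5, c_11 and h_2 each pass through a basis point, which leaves a determinant of order
   2; c_9 and c_7 avoid the basis points and need order 3. *)
- have := line 13 5 isT isT isT isT; have := line 6 5 isT isT isT isT.
  rewrite (q0 13) // (A0 4 5) // !mulr0 !addr0.
  exact: det2_eq0 (AN0 0 5 isT isT isT isT).
- have := line 15 11 isT isT isT isT; have := line 10 11 isT isT isT isT.
  rewrite (p0 15) // (A0 0 11) // !mulr0 !add0r.
  exact: det2_eq0 (AN0 4 11 isT isT isT isT).
- have := det3_eq0 (AN0 0 9 isT isT isT isT) (line 8 9 isT isT isT isT)
    (line 10 9 isT isT isT isT) (line 13 9 isT isT isT isT).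
  rewrite (r0 8) // (q0 13) // mulr0 subr0 mul0r addr0.
  by move=> /eqP; rewrite subr_eq0 => /eqP.
- have := det3_eq0 (AN0 0 7 isT isT isT isT) (line 6 7 isT isT isT isT)
    (line 8 7 isT isT isT isT) (line 15 7 isT isT isT isT).
  by rewrite (r0 8) // (p0 15) // !mul0r mulr0 !subr0.
- have := line 10 14 isT isT isT isT; have := line 6 14 isT isT isT isT.
  rewrite (A0 2 14) // !mulr0 !addr0 [p (vtx 10) * q (vtx 6)]mulrC.
  exact: det2_eq0 (AN0 0 14 isT isT isT isT).
Qed.

(** * Upper bounds from Gram matrices *)

Lemma psd_rank_gram (F : numFieldType) (theta : {rmorphism F -> F}) n k
    (G : sgraph n) (B : 'M[F]_(n, k)) :
  involutive theta -> (forall z, 0 <= theta z * z) ->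
  (forall i j, i != j -> ((B *m B ^t theta) i j == 0) = ~~ G i j) ->
  exists2 r, (r <= k)%N & psd_rank theta G r.
Proof.
move=> thetaK theta_ge0 BG.
have adjK p q (M : 'M[F]_(p, q)) : (M ^t theta) ^t theta = M.
  by apply/matrixP => i j; rewrite !mxE thetaK.
have adjM p q s (M : 'M[F]_(p, q)) (N : 'M_(q, s)) :
  (M *m N) ^t theta = N ^t theta *m M ^t theta.
  by rewrite trmx_mul map_mxM.
exists (\rank (B *m B ^t theta)).
  exact: leq_trans (mxrankM_maxl _ _) (rank_leq_col _).
exists (B *m B ^t theta); split=> //; first split.
- by apply/is_hermitianmxP; rewrite expr0 scale1r adjM adjK.
- move=> x; rewrite mulmxA -mulmxA -[x ^t theta *m B]adjK adjM adjK mxE.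
  by apply: sumr_ge0 => l _; rewrite !mxE.
- move=> i j; rewrite /mxgraph /=; case: eqVneq => [->|nij] /=.
    by rewrite adj_irr.
  by rewrite BG ?negbK.
Qed.

(** Turns the comparison of two patterns into a single boolean, to be evaluated. *)
Lemma H43_table (P : nat -> nat -> bool) a b :
  all (fun k => all (fun l => (k == l) || (P k l == H43_nat k l)) (iota 0 16))
    (iota 0 16) ->
  (a < 16)%N -> (b < 16)%N -> a != b -> P a b = H43_nat a b.
Proof.
move=> /allP table lta ltb nab; have := table a; rewrite mem_iota lta.
move=> /(_ isT) /allP /(_ b); rewrite mem_iota ltb (negPf nab).
by move=> /(_ isT) /eqP.
Qed.

(** Integer entries allow orthogonality to be computed once and transferred to every real field. *)
Definition real_vectors : seq (seq int) :=
  [:: [:: -1; 1; 1; 2]; [:: -3; 1; -2; -1]; [:: 1; 1; -1; 0];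
      [:: -1; -1; -2; 2]; [:: 1; 1; 0; 1]; [:: -4; 5; -2; -1];
      [:: -1; 0; 2; 0]; [:: 2; 2; 1; -1]; [:: 0; -1; 1; -1];
      [:: -2; -1; -2; -1]; [:: 1; 1; -1; -1]; [:: 0; 1; 3; -2];
      [:: 1; -4; -1; 3]; [:: 0; 0; -1; 2]; [:: -2; 1; -1; 0];
      [:: 1; -1; 1; 1]]%Z.

Definition real_dot (a b : nat) : int :=
  let c k l := nth 0 (nth [::] real_vectors k) l in
  c a 0%N * c b 0%N + (c a 1%N * c b 1%N +
  (c a 2%N * c b 2%N + c a 3%N * c b 3%N)).

Lemma real_dot_eq0 a b : (a < 16)%N -> (b < 16)%N -> a != b ->
  (real_dot a b == 0) = H43_nat a b.
Proof.
by apply: (H43_table (P := fun k l => real_dot k l == 0)); vm_compute.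
Qed.

Lemma compl_H43_psd_rank_real (R : realFieldType) :
  exists2 r, (r <= 4)%N & psd_rank (idfun : R -> R) (compl_graph H43) r.
Proof.
pose B : 'M[R]_(12 + 4, 4) :=
  \matrix_(i, l) (nth 0 (nth [::] real_vectors i) l)%:~R.
apply: (psd_rank_gram (B := B)) => // [z|i j nij].
  by rewrite -expr2 sqr_ge0.
have -> : (B *m B ^t idfun) i j = (real_dot i j)%:~R.
  by rewrite mxE !big_ord_recl big_ord0 addr0 !mxE /= !rmorphD !rmorphM.
rewrite intr_eq0 real_dot_eq0 // -H43_natE /= /compl_adj /= nij /=.
by rewrite negbK.
Qed.

(** * The complex realization over the Eisenstein integers *)

Lemma cube_root_unity (C : numClosedFieldType) :
  exists2 w : C, w ^+ 2 = - 1 - w & conjC w = - 1 - w.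
Proof.
pose s : C := sqrtC 3.
have s2 : s ^+ 2 = 3 by rewrite sqrtCK.
have sr : conjC s = s by rewrite conj_Creal // sqrtC_real // ler0n.
have n2 : (2 : C) != 0 by rewrite pnatr_eq0.
(* A primitive cube root of unity; its conjugate is its square. *)
exists ((- 1 + 'i * s) / 2).
  apply: (mulfI n2); apply: (mulfI n2).
  transitivity (1 - 'i * s *+ 2 + 'i ^+ 2 * s ^+ 2); first by rewrite mulr2n; field.
  by rewrite sqrCi s2 mulr2n; field.
rewrite rmorphM rmorphD rmorphM /= rmorphN rmorph1 conjCi sr fmorphV rmorph_nat.
by field.
Qed.

(* A pair (x, y) stands for the Eisenstein integer x + y w, where              *)
(* w ^+ 2 = - 1 - w.                                                           *)
Definition eis_mul_conj (x y : int * int) : int * int :=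
  (x.1 * y.1 - x.1 * y.2 + x.2 * y.2, x.2 * y.1 - x.1 * y.2).

(* The points realize the Moebius-Kantor configuration in coordinates for      *)
(* which no two of them are orthogonal, and neither are any two of the lines,  *)
(* the conjugated cross products of their points (up to a scalar).             *)
Definition complex_vectors : seq (seq (int * int)) :=
  [:: [:: (1, 0); (0, 1); (0, -1)]; [:: (-1, 0); (0, 0); (0, -1)];
      [:: (-1, 0); (1, 0); (0, 1)]; [:: (0, -1); (0, -1); (0, 0)];
      [:: (-1, 0); (1, 0); (-1, 0)]; [:: (0, -1); (0, 0); (0, 1)];
      [:: (0, 1); (1, 0); (0, 1)]; [:: (1, 0); (-1, -1); (-2, 0)];
      [:: (-1, 1); (0, -1); (0, 1)]; [:: (1, 0); (0, 0); (-1, 1)];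
      [:: (-1, 1); (1, 0); (0, 1)]; [:: (-1, 0); (0, -1); (0, -2)];
      [:: (0, 0); (0, -1); (0, -1)]; [:: (0, 0); (1, 1); (0, 0)];
      [:: (0, 0); (-1, 0); (0, 1)]; [:: (-2, 0); (2, 0); (-1, 1)]]%Z.

Definition complex_dot (a b : nat) : int * int :=
  let c k l := nth (0, 0) (nth [::] complex_vectors k) l in
  let d l := eis_mul_conj (c a l) (c b l) in
  ((d 0%N).1 + ((d 1%N).1 + (d 2%N).1), (d 0%N).2 + ((d 1%N).2 + (d 2%N).2)).

Lemma complex_dot_eq0 a b : (a < 16)%N -> (b < 16)%N -> a != b ->
  (complex_dot a b == (0, 0)) = H43_nat a b.
Proof.
by apply: (H43_table (P := fun k l => complex_dot k l == (0, 0))); vm_compute.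
Qed.

Section Eisenstein.
Variables (C : numClosedFieldType) (w : C).
Hypotheses (w2 : w ^+ 2 = - 1 - w) (wJ : conjC w = - 1 - w).

Definition eis (x : int * int) : C := x.1%:~R + x.2%:~R * w.

Lemma eis_mul_conjE x y : eis x * conjC (eis y) = eis (eis_mul_conj x y).
Proof.
have -> : conjC (eis y) = y.1%:~R + y.2%:~R * (- 1 - w).
  by rewrite -wJ /eis rmorphD rmorphM !rmorph_int.
rewrite /eis !(rmorphD, rmorphN, rmorphM) /=.
set a := x.1%:~R; set b := x.2%:~R; set c := y.1%:~R; set d := y.2%:~R.
transitivity (a * c - a * d + (b * c - b * d - a * d) * w - b * d * w ^+ 2).
  by ring.
by rewrite w2; ring.
Qed.

(** The norm a ^+ 2 - a * b + b ^+ 2 is positive definite, its double being a sum of squares, so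
    orthogonality can be tested on integer pairs. *)
Lemma eis_eq0 x : (eis x == 0) = (x == (0, 0)).
Proof.
apply/eqP/eqP => [x0|->]; last by rewrite /eis mul0r addr0.
have : eis (eis_mul_conj x x) = 0 by rewrite -eis_mul_conjE x0 mul0r.
case: x x0 => a b x0.
rewrite /eis /eis_mul_conj /= [b * a]mulrC subrr mul0r addr0.
move=> /eqP; rewrite intr_eq0 => /eqP e.
have : a ^+ 2 + b ^+ 2 + (a - b) ^+ 2 = 0.
  by transitivity ((a * a - a * b + b * b) *+ 2);
    [rewrite mulr2n; ring | rewrite e mul0rn].
move=> /eqP; rewrite paddr_eq0 ?addr_ge0 ?sqr_ge0 //.
by rewrite paddr_eq0 ?sqr_ge0 // !sqrf_eq0 => /andP[/andP[/eqP -> /eqP ->]].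
Qed.

Lemma compl_H43_psd_rank_complex :
  exists2 r, (r <= 3)%N & psd_rank (conjC : C -> C) (compl_graph H43) r.
Proof.
pose B : 'M[C]_(12 + 4, 3) :=
  \matrix_(i, l) eis (nth (0, 0) (nth [::] complex_vectors i) l).
apply: (psd_rank_gram (B := B)) => [|z|i j nij]; first exact: conjCK.
  by rewrite mulrC mul_conjC_ge0.
have -> : (B *m B ^t conjC) i j = eis (complex_dot i j).
  rewrite mxE !big_ord_recl big_ord0 addr0 !mxE !eis_mul_conjE /eis /complex_dot.
  by rewrite /= !rmorphD /=; ring.
rewrite eis_eq0 complex_dot_eq0 // -H43_natE /= /compl_adj /= nij /=.
by rewrite negbK.
Qed.

End Eisenstein.

Local Close Scope ring_scope.

Theorem mainTheorem5 (R : realType) :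
  mr_plusC R (compl_graph H43) = 3 /\ 3 < 4 /\
  4 = mr_plusR R (compl_graph H43).
Proof.
split; last split=> //; last apply/esym.
- rewrite /mr_plusC; case: ex_minnP => m /asboolP[A [_ gA rkA]] mmin.
  apply/eqP; rewrite eqn_leq -{2}rkA compl_H43_rank_ge3 // andbT.
  have [w w2 wJ] := cube_root_unity (complex R).
  have [r ler psdr] := compl_H43_psd_rank_complex w2 wJ.
  by apply: leq_trans ler; apply: mmin; apply/asboolP.
- rewrite /mr_plusR; case: ex_minnP => m /asboolP[A [_ gA rkA]] mmin.
  apply/eqP; rewrite eqn_leq -{2}rkA compl_H43_real_rank_ge4 // andbT.
  have [r ler psdr] := compl_H43_psd_rank_real R.
  by apply: leq_trans ler; apply: mmin; apply/asboolP.
Qed.
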